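(* Let $\omega:[1,\infty)\to\mathbb{R}$ be the Buchstab function, defined by $\omega(x)=1/x$ for $1\le x\le 2$ and by the condition that $x\omega(x)$ is differentiable with $\frac{\mathrm{d}}{\mathrm{d}x}\big(x\omega(x)\big)=\omega(x-1)$ for $x\ge 2$ ($\omega$ is continuous). For each integer $n\ge 1$, consider the Taylor expansion of $\omega$ on the unit interval $[n,n+1)$ in the centered variable $z$: $$\omega\Big(n+\frac{1+z}{2}\Big)=\sum_{i=0}^{\infty}c_{n,i}z^{i}\qquad\text{for } -1\le z<1,$$ where $c_{n,i}$ denotes the $i$-th coefficient of the $n$-th sequence. Then $$c_{1,i}=\frac{2}{3}\Big(\frac{-1}{3}\Big)^{i}\quad\text{for } i\ge 0,$$ $$c_{n+1,0}=\frac{1}{2n+3}\sum_{i=0}^{\infty}c_{n,i}\Big(2(n+1)+\frac{(-1)^{i}}{i+1}\Big)\quad\text{for } n>1,$$ $$c_{n+1,i}=\frac{1}{2n+3}\Big(\frac{c_{n,i-1}}{i}-c_{n+1,i-1}\Big)\quad\text{for } n>1 \text{ and } i\ge 1.$$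
   Context: The variable $z\in[-1,1)$ corresponds to the fractional part $t=(1+z)/2\in[0,1)$ of $x=n+t\in[n,n+1)$. *)

(* Defs.v *)
From Stdlib Require Import Reals.
From Coquelicot Require Import Coquelicot.
Open Scope R_scope.

(* [is_derive] with the neighbourhoods of [x] replaced by their traces on [D],
   so that the derivative is one-sided at an endpoint of an interval [D]. *)
Definition is_derive_within (D : R -> Prop) (f : R -> R) (x l : R) : Prop :=
  filterdiff f (within D (locally x)) (fun y => scal y l).

(* The function lives on [1, oo); a total [w : R -> R] represents it and its
   values below 1 are unconstrained.  The derivative is taken relative to
   [2, oo): a two-sided derivative at 2 would be contradictory, since
   [x * w x] is constant on [1, 2] while [w (2 - 1) = 1]. *)
Definition is_buchstab (w : R -> R) : Prop :=
  (forall x, 1 <= x <= 2 -> w x = 1 / x) /\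
  (forall x, 2 <= x ->
     is_derive_within (fun y => 2 <= y) (fun y => y * w y) x (w (x - 1))) /\
  continuous_on (fun x => 1 <= x) w.

(* Row [c 0] is irrelevant: rows are indexed by [n >= 1]. *)
Definition is_centered_expansion (w : R -> R) (c : nat -> nat -> R) : Prop :=
  forall n : nat, (1 <= n)%nat -> forall z : R, -1 <= z < 1 ->
    is_series (fun i : nat => c n i * z ^ i) (w (INR n + (1 + z) / 2)).

(* Main.v *)
(** Multiplying by [2n + 3 + z = 2x], where [x = n + 1 + (1 + z) / 2], turns the
    differential equation into [d/dz ((2n + 3 + z) f_(n+1) (z)) = f_n (z)] for
    [f_n (z) = w (n + (1 + z) / 2)].  The announced recurrence is the coefficientwise
    form of this equation, with the constant term fixed by [f_(n+1) (-1) = f_n (1)].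
    The rows it generates from the geometric row [2 / (3 + z)] are [O (2^-i)], so
    their power series converge beyond [|z| = 1]; the mean value theorem identifies
    them with [w], and uniqueness of power series coefficients transfers the
    recurrence to any other expansion. *)
Require Import Defs.
From Stdlib Require Import Reals Lra Lia.
From Coquelicot Require Import Coquelicot.
Open Scope R_scope.

(** * Coefficient sequences of size O(2^-i) *)

(** The rate 1/2 gives a radius of convergence of at least 2, so both endpoints z = -1 and z = 1 lie
    inside the disk, and the recurrence preserves this rate. *)
Definition half_geometric (a : nat -> R) : Prop :=
  exists C : R, forall i : nat, Rabs (a i) <= C * (1 / 2) ^ i.

Lemma half_geometric_ex_series (a : nat -> R) : half_geometric a -> ex_series a.
Proof.
  intros [C HC].
  apply (ex_series_le a (fun i => C * (1 / 2) ^ i)).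
  - exact HC.
  - apply (ex_series_scal C (fun i => (1 / 2) ^ i)), ex_series_geom.
    rewrite Rabs_pos_eq; lra.
Qed.

Lemma half_geometric_mult (a b : nat -> R) (M : R) :
  half_geometric a -> (forall i, Rabs (b i) <= M) ->
  half_geometric (fun i => a i * b i).
Proof.
  intros [C HC] Hb. exists (C * M). intros i.
  rewrite Rabs_mult.
  apply Rle_trans with ((C * (1 / 2) ^ i) * M).
  - apply Rmult_le_compat; auto using Rabs_pos.
  - right; ring.
Qed.

Lemma half_geometric_CV_radius (a : nat -> R) (z : R) :
  half_geometric a -> Rabs z < 2 -> Rbar_lt (Rabs z) (CV_radius a).
Proof.
  intros [C HC] Hz.
  apply Rbar_lt_le_trans with 2; [exact Hz|].
  apply (proj1 (CV_radius_bounded a)).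
  exists C. intros i.
  rewrite Rabs_mult, (Rabs_pos_eq (2 ^ i)) by (apply pow_le; lra).
  apply Rle_trans with (C * (1 / 2) ^ i * 2 ^ i).
  - apply Rmult_le_compat_r; [apply pow_le; lra | apply HC].
  - rewrite Rmult_assoc, <- Rpow_mult_distr.
    replace (1 / 2 * 2) with 1 by field. rewrite pow1; lra.
Qed.

Lemma half_geometric_ex_pseries (a : nat -> R) (z : R) :
  half_geometric a -> Rabs z < 2 -> ex_pseries a z.
Proof.
  intros Ha Hz. now apply CV_radius_inside, half_geometric_CV_radius.
Qed.

Lemma inv_INR_S_bound (i : nat) : 0 < / INR (S i) <= 1.
Proof.
  rewrite S_INR. pose proof (pos_INR i). split.
  - apply Rinv_0_lt_compat; lra.
  - rewrite <- Rinv_1. apply Rinv_le_contravar; lra.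
Qed.

(** * Rows generated by the recurrence *)

(** Here [n] is the index of the input row [a]; the output is the row of index n + 1. *)
Fixpoint next_row (n : nat) (a : nat -> R) (i : nat) : R :=
  match i with
  | O => 1 / (2 * INR n + 3) *
         Series (fun j => a j * (2 * (INR n + 1) + (-1) ^ j / (INR j + 1)))
  | S j => 1 / (2 * INR n + 3) * (a j / INR (S j) - next_row n a j)
  end.

(* [row k] holds the coefficients on [[k + 1, k + 2)]. *)
Fixpoint row (k : nat) : nat -> R :=
  match k with
  | O => fun i => 2 / 3 * (-1 / 3) ^ i
  | S k' => next_row k (row k')
  end.

Lemma half_geometric_row_sum (n : nat) (a : nat -> R) :
  half_geometric a ->
  half_geometric (fun j => a j * (2 * (INR n + 1) + (-1) ^ j / (INR j + 1))).
Proof.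
  intros Ha. apply half_geometric_mult with (2 * (INR n + 1) + 1); [exact Ha|].
  intros j. pose proof (inv_INR_S_bound j) as Hj. rewrite S_INR in Hj.
  eapply Rle_trans; [apply Rabs_triang|].
  unfold Rdiv. rewrite (Rabs_mult ((-1) ^ j)), pow_1_abs.
  pose proof (pos_INR n).
  rewrite !Rabs_pos_eq; lra.
Qed.

(** For [1 <= n] the prefactor is at most 1/5, so two terms bounded by M 2^-i produce at most (2/5)
    M 2^-i, which is below M 2^-(i+1). *)
Lemma half_geometric_next_row (n : nat) (a : nat -> R) :
  (1 <= n)%nat -> half_geometric a -> half_geometric (next_row n a).
Proof.
  intros Hn [C HC].
  (* The maximum covers the constant coefficient, which comes from a series and not from the step of
     the recurrence. *)
  exists (Rmax C (Rabs (next_row n a 0))).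
  set (M := Rmax _ _).
  pose proof (Rmax_l C (Rabs (next_row n a 0)) : C <= M) as HCM.
  pose proof (Rmax_r C (Rabs (next_row n a 0)) : _ <= M) as H0M.
  assert (HM : 0 <= M) by (pose proof (Rabs_pos (next_row n a 0)); lra).
  apply le_INR in Hn. simpl in Hn.
  assert (Hd : 0 < 1 / (2 * INR n + 3) <= 1 / 5).
  { split; [apply Rdiv_lt_0_compat; lra|].
    apply Rmult_le_compat_l, Rinv_le_contravar; lra. }
  induction i as [|i IH]; [simpl in *; lra|].
  change (next_row n a (S i)) with
    (1 / (2 * INR n + 3) * (a i / INR (S i) - next_row n a i)).
  rewrite Rabs_mult, (Rabs_pos_eq (1 / _)) by lra.
  assert (Hp : 0 <= (1 / 2) ^ i) by (apply pow_le; lra).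
  assert (Ha : Rabs (a i / INR (S i)) <= M * (1 / 2) ^ i).
  { unfold Rdiv at 1. rewrite Rabs_mult.
    pose proof (inv_INR_S_bound i).
    rewrite (Rabs_pos_eq (/ _)) by lra.
    specialize (HC i). pose proof (Rabs_pos (a i)).
    apply Rle_trans with (Rabs (a i) * 1).
    - apply Rmult_le_compat_l; lra.
    - pose proof (Rmult_le_compat_r _ _ _ Hp HCM). lra. }
  assert (Hb : Rabs (a i / INR (S i) - next_row n a i) <= 2 * (M * (1 / 2) ^ i)).
  { unfold Rminus. eapply Rle_trans; [apply Rabs_triang|].
    rewrite Rabs_Ropp. lra. }
  pose proof (Rmult_le_pos _ _ HM Hp).
  apply Rle_trans with (1 / 5 * (2 * (M * (1 / 2) ^ i))).
  - apply Rmult_le_compat; try lra. apply Rabs_pos.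
  - simpl. lra.
Qed.

Lemma half_geometric_row (k : nat) : half_geometric (row k).
Proof.
  induction k as [|k IH].
  - exists (2 / 3). intros i. simpl.
    rewrite Rabs_mult, <- RPow_abs, (Rabs_pos_eq (2 / 3)) by lra.
    apply Rmult_le_compat_l; [lra|].
    apply pow_incr. split; [apply Rabs_pos|].
    rewrite Rabs_left; lra.
  - apply half_geometric_next_row; [lia | exact IH].
Qed.

(** * The primitive (2n + 3 + z) f_(n+1) (z) *)

(** Coefficients of the product of 2n + 3 + z with the series of [next_row n a]; [PS_incr_1] is
    multiplication by z. *)
Definition next_row_primitive (n : nat) (a : nat -> R) : nat -> R :=
  PS_plus (PS_scal (2 * INR n + 3) (next_row n a)) (PS_incr_1 (next_row n a)).

Lemma next_row_primitive_0 (n : nat) (a : nat -> R) :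
  next_row_primitive n a 0 =
    Series (fun j => a j * (2 * (INR n + 1) + (-1) ^ j / (INR j + 1))).
Proof.
  unfold next_row_primitive, PS_plus, PS_scal, PS_incr_1, plus, scal, zero; simpl.
  unfold mult; simpl. pose proof (pos_INR n). field. lra.
Qed.

(** The recurrence solved for a_i / (i + 1): these are the coefficients of an antiderivative of the
    series of [a]. *)
Lemma next_row_primitive_S (n : nat) (a : nat -> R) (i : nat) :
  next_row_primitive n a (S i) = a i / INR (S i).
Proof.
  unfold next_row_primitive, PS_plus, PS_scal, PS_incr_1, plus, scal.
  change (next_row n a (S i)) with
    (1 / (2 * INR n + 3) * (a i / INR (S i) - next_row n a i)).
  cbn -[INR]. unfold mult; cbn -[INR].
  pose proof (pos_INR n). pose proof (pos_INR i).
  assert (INR (S i) <> 0) by (rewrite S_INR; lra).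
  field; repeat split; lra.
Qed.

Lemma half_geometric_next_row_primitive (n : nat) (a : nat -> R) :
  half_geometric a -> half_geometric (next_row_primitive n a).
Proof.
  intros [C HC].
  set (K := Rabs (next_row_primitive n a 0)).
  assert (HC0 : 0 <= C).
  { specialize (HC 0%nat). pose proof (Rabs_pos (a 0%nat)). simpl in HC. lra. }
  (* The factor 2 pays for the index shift from i to i + 1, and [K] for the constant term. *)
  exists (2 * C + K). intros [|i].
  - fold K. simpl. lra.
  - rewrite next_row_primitive_S. unfold Rdiv at 1. rewrite Rabs_mult.
    pose proof (inv_INR_S_bound i).
    rewrite (Rabs_pos_eq (/ _)) by lra.
    assert (Hp : 0 <= (1 / 2) ^ i) by (apply pow_le; lra).
    assert (HK : 0 <= K * (1 / 2) ^ i)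
      by (apply Rmult_le_pos; [apply Rabs_pos | exact Hp]).
    apply Rle_trans with (C * (1 / 2) ^ i * 1).
    + apply Rmult_le_compat; auto using Rabs_pos; lra.
    + simpl. lra.
Qed.

Lemma PSeries_next_row_primitive (n : nat) (a : nat -> R) (z : R) :
  (1 <= n)%nat -> half_geometric a -> Rabs z < 2 ->
  PSeries (next_row_primitive n a) z =
    (2 * INR n + 3 + z) * PSeries (next_row n a) z.
Proof.
  intros Hn Ha Hz.
  assert (He : ex_pseries (next_row n a) z)
    by now apply half_geometric_ex_pseries; [apply half_geometric_next_row|].
  unfold next_row_primitive.
  rewrite PSeries_plus, PSeries_scal, PSeries_incr_1.
  - ring.
  - apply ex_pseries_scal; [apply Rmult_comm | exact He].
  - now apply ex_pseries_incr_1.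
Qed.

Lemma is_derive_next_row_primitive (n : nat) (a : nat -> R) (z : R) :
  half_geometric a -> Rabs z < 2 ->
  is_derive (PSeries (next_row_primitive n a)) z (PSeries a z).
Proof.
  intros Ha Hz.
  replace (PSeries a z) with (PSeries (PS_derive (next_row_primitive n a)) z).
  - apply is_derive_PSeries, half_geometric_CV_radius; [|exact Hz].
    now apply half_geometric_next_row_primitive.
  - apply PSeries_ext. intros i. unfold PS_derive.
    rewrite next_row_primitive_S. field.
    rewrite S_INR. pose proof (pos_INR i). lra.
Qed.

(** The constant coefficient is chosen for this matching: at z = -1 the alternating part of its sum
    cancels the higher terms of the primitive, leaving 2 (n + 1) times the sum of [a], while 2n + 3
    + z becomes 2 (n + 1). *)
Lemma PSeries_next_row_m1 (n : nat) (a : nat -> R) :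
  (1 <= n)%nat -> half_geometric a -> PSeries (next_row n a) (-1) = PSeries a 1.
Proof.
  intros Hn Ha.
  assert (Hm1 : Rabs (-1) < 2) by (rewrite Rabs_left; lra).
  pose proof (PSeries_next_row_primitive n a (-1) Hn Ha Hm1) as H.
  assert (Halt : ex_series (fun j => a j * ((-1) ^ j / (INR j + 1)))).
  { apply half_geometric_ex_series, half_geometric_mult with 1; [exact Ha|].
    intros j. pose proof (inv_INR_S_bound j) as Hj. rewrite S_INR in Hj.
    unfold Rdiv. rewrite Rabs_mult, pow_1_abs, Rabs_pos_eq; lra. }
  assert (H1 : PSeries (next_row_primitive n a) (-1) =
               2 * (INR n + 1) * PSeries a 1).
  { rewrite PSeries_decr_1, next_row_primitive_0.
    - unfold PSeries, PS_decr_1.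
      rewrite (Series_ext (fun k => next_row_primitive n a (S k) * (-1) ^ k)
                 (fun j => a j * ((-1) ^ j / (INR j + 1)))).
      + rewrite (Series_ext _ (fun j => 2 * (INR n + 1) * (a j * 1 ^ j) +
                                      a j * ((-1) ^ j / (INR j + 1)))).
        * rewrite Series_plus, Series_scal_l; [ring| |exact Halt].
          apply (ex_series_scal (2 * (INR n + 1)) (fun j => a j * 1 ^ j)).
          apply half_geometric_ex_series, half_geometric_mult with 1;
            [exact Ha|].
          intros j. rewrite pow1, Rabs_R1. lra.
        * intros j. rewrite pow1. ring.
      + intros j. rewrite next_row_primitive_S, S_INR. field.
        pose proof (pos_INR j). lra.
    - apply half_geometric_ex_pseries; [|exact Hm1].
      now apply half_geometric_next_row_primitive. }
  rewrite H1 in H. pose proof (pos_INR n).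
  apply Rmult_eq_reg_l with (2 * (INR n + 1)); lra.
Qed.

(** * Identification of the rows with the Buchstab function *)

Lemma is_derive_within_interior (D : R -> Prop) (f : R -> R) (x l : R) :
  locally x D -> is_derive_within D f x l -> is_derive f x l.
Proof.
  intros HD [Hlin H]. split; [exact Hlin|].
  intros y Hy eps.
  (* [filterdiff] speaks of every limit of the filter; [x] is the only limit of [locally x]. *)
  pose proof (@is_filter_lim_locally_unique _ R_NormedModule x y Hy). subst y.
  assert (Hx : is_filter_lim (within D (locally x)) x).
  { intros P HP. unfold within. revert HP. apply filter_imp. auto. }
  specialize (H x Hx eps). unfold within in H.
  generalize (filter_and _ _ HD H). apply filter_imp. intros y [Dy HyD].
  now apply HyD.
Qed.

Lemma buchstab_continuous (w : R -> R) (x : R) :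
  is_buchstab w -> 1 < x -> continuous w x.
Proof.
  intros (_ & _ & Hc) Hx.
  apply (continuous_continuous_on (fun x => 1 <= x)); [|exact Hc].
  apply filter_imp with (fun y => 1 < y); [intros; lra | now apply open_gt].
Qed.

Lemma buchstab_is_derive (w : R -> R) (x : R) :
  is_buchstab w -> 2 < x -> is_derive (fun y => y * w y) x (w (x - 1)).
Proof.
  intros (_ & Hd & _) Hx.
  apply is_derive_within_interior with (D := fun y => 2 <= y).
  - apply filter_imp with (fun y => 2 < y); [intros; lra | now apply open_gt].
  - apply Hd; lra.
Qed.

(** Derivatives are asked only on the open interval, because x w(x) has just a one-sided derivative
    at x = 2. *)
Lemma derive_zero_const (f : R -> R) (a b : R) :
  a <= b ->
  (forall x, a < x < b -> is_derive f x 0) ->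
  (forall x, a <= x <= b -> continuous f x) ->
  f b = f a.
Proof.
  intros Hab Hd Hc.
  destruct (MVT_gen f a b (fun _ => 0)) as (c & _ & H).
  - rewrite Rmin_left, Rmax_right by lra. exact Hd.
  - rewrite Rmin_left, Rmax_right by lra.
    intros x Hx. now apply continuity_pt_filterlim, Hc.
  - lra.
Qed.

(** Past n + 1, x w(x) and half the primitive have the same derivative w(x - 1), and they agree at n
    + 1, so they coincide; dividing by x gives the claim. *)
Lemma buchstab_next_row (w : R -> R) (n : nat) (a : nat -> R) :
  is_buchstab w -> (1 <= n)%nat -> half_geometric a ->
  (forall z, -1 <= z <= 1 -> PSeries a z = w (INR n + (1 + z) / 2)) ->
  forall z, -1 <= z <= 1 ->
    PSeries (next_row n a) z = w (INR (S n) + (1 + z) / 2).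
Proof.
  intros Hw Hn Ha Heq z Hz.
  pose proof (le_INR _ _ Hn) as Hn'. simpl in Hn'.
  (* [zeta] inverts x = n + 1 + (1 + z) / 2; its slope 2 is why the primitive is halved in [f]. *)
  set (zeta := fun x => 2 * (x - INR n) - 3).
  set (f := fun x => x * w x - / 2 * PSeries (next_row_primitive n a) (zeta x)).
  assert (Hzeta : forall x, INR n + 1 <= x <= INR n + 2 -> Rabs (zeta x) < 2).
  { intros x Hx. unfold zeta. apply Rabs_def1; lra. }
  assert (Hprim : forall x, INR n + 1 <= x <= INR n + 2 ->
    is_derive (fun x => / 2 * PSeries (next_row_primitive n a) (zeta x)) x
      (PSeries a (zeta x))).
  { intros x Hx.
    replace (PSeries a (zeta x)) with (/ 2 * (2 * PSeries a (zeta x))) by field.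
    apply (is_derive_scal
             (fun x => PSeries (next_row_primitive n a) (zeta x)) x (/ 2)).
    apply (is_derive_comp (PSeries (next_row_primitive n a)) zeta).
    - apply is_derive_next_row_primitive; auto.
    - unfold zeta. auto_derive; [exact I | ring]. }
  (* The left end uses [Heq] at z = 1, where n + (1 + z) / 2 = n + 1. *)
  assert (Hf0 : f (INR n + 1) = 0).
  { unfold f.
    replace (zeta (INR n + 1)) with (-1) by (unfold zeta; ring).
    rewrite PSeries_next_row_primitive, PSeries_next_row_m1, Heq; auto; try lra.
    - replace (INR n + (1 + 1) / 2) with (INR n + 1) by field. field.
    - rewrite Rabs_left; lra. }
  set (x := INR (S n) + (1 + z) / 2).
  assert (Hx : x = INR n + 1 + (1 + z) / 2) by (unfold x; rewrite S_INR; lra).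
  assert (Hf : f x = f (INR n + 1)).
  { apply derive_zero_const; [lra| |].
    - intros y Hy. unfold f.
      replace 0 with (w (y - 1) - PSeries a (zeta y)).
      + apply (is_derive_minus (fun x => x * w x)).
        * apply buchstab_is_derive; [exact Hw | lra].
        * apply Hprim; lra.
      + rewrite Heq by (unfold zeta; lra).
        replace (INR n + (1 + zeta y) / 2) with (y - 1)
          by (unfold zeta; field). ring.
    - intros y Hy. unfold f.
      apply (continuous_minus (fun x => x * w x)).
      + apply (continuous_mult (fun x => x) w); [apply continuous_id|].
        apply buchstab_continuous; [exact Hw | lra].
      + apply ex_derive_continuous. eexists. apply Hprim. lra. }
  rewrite Hf0 in Hf. unfold f in Hf.
  replace (zeta x) with z in Hf by (unfold zeta; rewrite Hx; field).
  rewrite PSeries_next_row_primitive in Hf; auto; [|apply Rabs_def1; lra].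
  replace (2 * INR n + 3 + z) with (2 * x) in Hf by (rewrite Hx; field).
  apply Rmult_eq_reg_l with x; lra.
Qed.

(** The endpoint z = 1 is included, beyond the range of the expansion, because the induction step
    matches consecutive intervals there. *)
Lemma buchstab_row (w : R -> R) (k : nat) (z : R) :
  is_buchstab w -> -1 <= z <= 1 ->
  PSeries (row k) z = w (INR (S k) + (1 + z) / 2).
Proof.
  intros Hw. revert z. induction k as [|k IH]; intros z Hz.
  - destruct Hw as (Hinv & _ & _).
    rewrite Hinv by (simpl; lra).
    apply is_series_unique.
    (* On the first interval 1 / x = 2 / (3 + z), a geometric series of ratio -z/3. *)
    apply is_series_ext with (fun i => scal (2 / 3) ((- z / 3) ^ i)).
    + intros i. unfold scal; simpl; unfold mult; simpl.
      replace (- z / 3) with (-1 / 3 * z) by field.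
      rewrite Rpow_mult_distr. ring.
    + replace (1 / (INR 1 + (1 + z) / 2)) with (scal (2 / 3) (/ (1 - - z / 3))).
      * apply (is_series_scal (2 / 3 : R_AbsRing) (fun i => (- z / 3) ^ i)).
        apply is_series_geom.
        apply Rabs_def1; lra.
      * unfold scal; simpl; unfold mult; simpl. field; repeat split; lra.
  - apply (buchstab_next_row w (S k) (row k)); auto.
    + lia.
    + apply half_geometric_row.
Qed.

(** * Existence and uniqueness of the expansion *)

Lemma row_is_centered_expansion (w : R -> R) :
  is_buchstab w -> is_centered_expansion w (fun n => row (pred n)).
Proof.
  intros Hw n Hn z Hz.
  destruct n as [|k]; [lia|]. simpl pred.
  rewrite <- buchstab_row by (auto; lra).
  apply Series_correct, ex_pseries_R, half_geometric_ex_pseries.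
  - apply half_geometric_row.
  - apply Rabs_def1; lra.
Qed.

Lemma centered_expansion_unique (w : R -> R) (c d : nat -> nat -> R) :
  is_centered_expansion w c -> is_centered_expansion w d ->
  forall n i : nat, (1 <= n)%nat -> c n i = d n i.
Proof.
  assert (Hrad : forall e, is_centered_expansion w e ->
    forall n, (1 <= n)%nat -> Rbar_lt 0 (CV_radius (e n))).
  { intros e He n Hn.
    (* The series converges at z = 1/2; were the radius smaller, its terms there could not tend to
       0. *)
    apply Rbar_lt_le_trans with (1 / 2); [simpl; lra|].
    apply Rbar_not_lt_le. intros Hlt.
    apply (CV_disk_outside (e n) (1 / 2)).
    - rewrite Rabs_pos_eq; [exact Hlt | lra].
    - apply is_lim_seq_ext with (fun i => e n i * (1 / 2) ^ i); [reflexivity|].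
      apply ex_series_lim_0. eexists. apply He; [exact Hn | lra]. }
  intros Hc Hd n i Hn.
  apply PSeries_ext_recip; [eauto.. |].
  exists (mkposreal 1 Rlt_0_1). intros z Hz.
  change (Rabs (z - 0) < 1) in Hz. apply Rabs_def2 in Hz.
  unfold PSeries.
  rewrite (is_series_unique _ _ (Hc n Hn z ltac:(lra))).
  rewrite (is_series_unique _ _ (Hd n Hn z ltac:(lra))).
  reflexivity.
Qed.

Theorem theorem3 (w : R -> R) (hw : is_buchstab w) :
  (exists c : nat -> nat -> R, is_centered_expansion w c) /\
  (forall c : nat -> nat -> R, is_centered_expansion w c ->
     (forall i : nat, c 1%nat i = 2 / 3 * (-1 / 3) ^ i) /\
     (forall n : nat, (1 < n)%nat ->
        ex_series (fun i : nat =>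
          c n i * (2 * (INR n + 1) + (-1) ^ i / (INR i + 1))) /\
        c (n + 1)%nat 0%nat =
          1 / (2 * INR n + 3) *
          Series (fun i : nat =>
            c n i * (2 * (INR n + 1) + (-1) ^ i / (INR i + 1)))) /\
     (forall n i : nat, (1 < n)%nat -> (1 <= i)%nat ->
        c (n + 1)%nat i =
          1 / (2 * INR n + 3) *
          (c n (i - 1)%nat / INR i - c (n + 1)%nat (i - 1)%nat))).
Proof.
  pose proof (row_is_centered_expansion w hw) as Hrow.
  split; [eexists; exact Hrow|].
  intros c Hc.
  assert (Heq : forall k i, c (S k) i = row k i).
  { intros k i. apply (centered_expansion_unique w c _ Hc Hrow (S k) i). lia. }
  split; [|split].
  - intros i. apply Heq.
  - intros n Hn. destruct n as [|k]; [lia|].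
    assert (Hext : forall i,
      row k i * (2 * (INR (S k) + 1) + (-1) ^ i / (INR i + 1)) =
      c (S k) i * (2 * (INR (S k) + 1) + (-1) ^ i / (INR i + 1)))
      by (intros i; now rewrite Heq).
    split.
    + apply (ex_series_ext _ _ Hext), half_geometric_ex_series.
      apply half_geometric_row_sum, half_geometric_row.
    + rewrite <- (Series_ext _ _ Hext).
      replace (S k + 1)%nat with (S (S k)) by lia.
      (* [row (S k)] unfolds to [next_row (S k) (row k)], so the recurrence holds by computation. *)
      rewrite Heq. reflexivity.
  - intros n i Hn Hi.
    destruct n as [|k]; [lia|]. destruct i as [|j]; [lia|].
    replace (S k + 1)%nat with (S (S k)) by lia.
    replace (S j - 1)%nat with j by lia.
    rewrite !Heq. reflexivity.
Qed.
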